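(* Let $D\ge2$, let $\Lambda$ be a parabolic subfamily of $\mathrm{rat}^{cm}_D$, $\Omega$ a $\Lambda$-hyperbolic component, $\widetilde\Omega$ a lift of $\Omega$ to $\mathrm{Rat}^{cm}_D$, and $\eta\in(0,\log D)$. Fix $\lambda_0\in\widetilde\Omega$. Then $G_{\lambda_0}(\lambda_0)\le G_{\lambda_0}(\lambda)$ for all $\lambda\in U(\lambda_0)$.
   Context: **Families.** $\mathrm{Rat}^{cm}_D$ is the space of degree $D$ rational maps with marked critical points, and $\mathrm{rat}^{cm}_D$ its quotient by Möbius conjugacy. $f_\lambda$ is the rational map corresponding to $\lambda$ and $J_\lambda$ its Julia set. A *parabolic subfamily* $\Lambda$ is an algebraic subfamily such that a (possibly empty) subset of the critical points is persistently attracted by a parabolic periodic point, i.e. a family defined by a finite (possibly empty) set of persistent parabolic relations. A critical point $c$ is *passive* on an open set if $\{\lambda\mapsto f^n_\lambda(c(\lambda))\}_{n\ge1}$ is normal there, and *active* otherwise. A *stable component* is a connected component of the largest open set on which all critical points are passive. A stable component $\Omega$ is *$\Lambda$-hyperbolic* if for every $\lambda\in\Omega$ all critical points active on $\Lambda$ lie in the basin of some attracting cycle of $f_\lambda$. **Holomorphic motion.** $U(\lambda_0)\subset\widetilde\Omega$ is a neighbourhood of $\lambda_0$ on which the holomorphic motion of Julia sets gives well-defined Hölder conjugacies $\Psi_\lambda:J_{\lambda_0}\to J_\lambda$, $\Psi_\lambda\circ f_{\lambda_0}=f_\lambda\circ\Psi_\lambda$, $\Psi_{\lambda_0}=\mathrm{id}$.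 **The function $G_{\lambda_0}$.** $\mathcal P(\phi)=\sup_m(h_m(f)+\int\phi\,dm)$ over invariant probability measures on the Julia set; maximizing measures are equilibrium states. $\delta_\eta(\lambda)$ is the unique real number with $\mathcal P(-\delta_\eta(\lambda)\log|f'_\lambda|)=\eta$ (pressure for $f_\lambda$ on $J_\lambda$). $\nu$ is the unique equilibrium state on $J_{\lambda_0}$ of $-\delta_\eta(\lambda_0)\log|f'_{\lambda_0}|$, and $$G_{\lambda_0}(\lambda)=\delta_\eta(\lambda)\int_{J_{\lambda_0}}\log|f'_\lambda\circ\Psi_\lambda|\,d\nu,\qquad\lambda\in U(\lambda_0).$$ $|f'|$ is the modulus of the derivative in an affine coordinate in which the Julia set lies in $\mathbb C$ (or the spherical derivative; the logarithms differ by a continuous coboundary, so $G_{\lambda_0}$ is unaffected). *)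

(* Defs.v *)
From HB Require Import structures.
From mathcomp Require Import all_boot all_order all_algebra.
From mathcomp Require Import all_classical all_reals all_analysis.
From mathcomp Require Import complex.
From mathcomp Require mpoly.
Set Implicit Arguments.
Unset Strict Implicit.
Unset Printing Implicit Defensive.
Import Order.TTheory GRing.Theory Num.Theory.
Import numFieldNormedType.Exports.
Local Open Scope classical_set_scope.
Local Open Scope ring_scope.
Local Open Scope quotient_scope.

(* The alias makes R[i] inherit the norm topology of a [numFieldType]. *)
Definition Cx (R : realType) : numClosedFieldType := R[i].

Definition cmod (R : realType) (z : Cx R) : R := Normc.normc z.

(** * The Riemann sphere *)

Definition sphere (R : realType) : Type := one_point_compactification (Cx R).
HB.instance Definition _ (R : realType) := Topological.on (sphere R).
HB.instance Definition _ (R : realType) := Pointed.on (sphere R).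

Definition borel_sphere (R : realType) := g_sigma_algebraType (@open (sphere R)).

Section Sphere.
Variable R : realType.
Local Notation C := (Cx R).

(* z <-> [z : 1] and oo <-> [1 : 0] *)
Definition hcoord (z : sphere R) : 'rV[C]_2 :=
  if z is Some w then \row_j [:: w; 1]`_j else \row_j [:: 1; 0]`_j.

(* The point [v_0 : v_1]; meaningful for v != 0. *)
Definition of_hcoord (v : 'rV[C]_2) : sphere R :=
  if v 0 1 == 0 then None else Some (v 0 0 / v 0 1).

Definition wedge (u v : 'rV[C]_2) : C := u 0 0 * v 0 1 - u 0 1 * v 0 0.

Definition hnorm (v : 'rV[C]_2) : R :=
  Num.sqrt (cmod (v 0 0) ^+ 2 + cmod (v 0 1) ^+ 2).

(* In affine coordinates: 2|z - w| / (sqrt (1 + |z|^2) sqrt (1 + |w|^2)). *)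
Definition chordal (z w : sphere R) : R :=
  2 * cmod (wedge (hcoord z) (hcoord w)) / (hnorm (hcoord z) * hnorm (hcoord w)).

Definition mobius (M : 'M[C]_2) (z : sphere R) : sphere R :=
  of_hcoord (hcoord z *m M).

Lemma hcoord_neq0 (z : sphere R) : hcoord z != 0.
Proof.
apply/eqP => /rowP; case: z => [w|] => [/(_ 1)|/(_ 0)];
  by rewrite !mxE /= => /eqP; rewrite oner_eq0.
Qed.

Lemma hcoordK (z : sphere R) : of_hcoord (hcoord z) = z.
Proof.
by case: z => [w|]; rewrite /of_hcoord !mxE /= ?eqxx // oner_eq0 divr1.
Qed.

Lemma of_hcoordK (v : 'rV[C]_2) : v != 0 ->
  exists2 a : C, a != 0 & v = a *: hcoord (of_hcoord v).
Proof.
move=> v0; rewrite /of_hcoord; case: ifPn => [/eqP v1|v1].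
  exists (v 0 0).
    apply: contra v0 => /eqP v00; apply/eqP/rowP => j; rewrite !mxE.
    by have [->|->] : j = 0 \/ j = 1
      by case: j => [[|[|//]] ?]; [left|right]; apply/val_inj.
  apply/rowP => j; have [->|->] : j = 0 \/ j = 1
      by case: j => [[|[|//]] ?]; [left|right]; apply/val_inj.
    by rewrite !mxE /= mulr1.
  by rewrite !mxE /= mulr0.
exists (v 0 1) => //; apply/rowP => j; have [->|->] : j = 0 \/ j = 1
      by case: j => [[|[|//]] ?]; [left|right]; apply/val_inj.
  by rewrite !mxE /= mulrC divfK.
by rewrite !mxE /= mulr1.
Qed.

Lemma of_hcoordZ (a : C) (v : 'rV[C]_2) : a != 0 ->
  of_hcoord (a *: v) = of_hcoord v.
Proof.
move=> a0; rewrite /of_hcoord !mxE mulf_eq0 (negbTE a0) /=.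
by case: ifP => // _; rewrite -mulf_div divff // mul1r.
Qed.

Lemma mobius1 (z : sphere R) : mobius 1%:M z = z.
Proof. by rewrite /mobius mulmx1 hcoordK. Qed.

Lemma mobiusM (M N : 'M[C]_2) (z : sphere R) : M \in unitmx ->
  mobius N (mobius M z) = mobius (M *m N) z.
Proof.
move=> uM; rewrite {1}/mobius {2}/mobius mulmxA.
have nz : hcoord z *m M != 0.
  apply: contra (hcoord_neq0 z) => /eqP h.
  by rewrite -[hcoord z](mulmxK uM) h mul0mx.
rewrite /mobius; have [a a0 {2}->] := of_hcoordK nz.
by rewrite -scalemxAl of_hcoordZ.
Qed.

Lemma mobiusK (M : 'M[C]_2) : M \in unitmx -> cancel (mobius M) (mobius (invmx M)).
Proof. by move=> uM z; rewrite mobiusM // mulmxV // mobius1. Qed.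

Lemma mobiusVK (M : 'M[C]_2) : M \in unitmx -> cancel (mobius (invmx M)) (mobius M).
Proof. by move=> uM z; rewrite mobiusM ?unitmx_inv // mulVmx // mobius1. Qed.

End Sphere.

(** * Rational maps with marked critical points

   Multihomogeneous coordinates on P^(2D+1) x (P^1)^(2D-2).  The rows of the
   first matrix are the coefficients of homogeneous forms P, Q of degree D, with
   P(x,y) = \sum_i a_i x^i y^(D-i); those of the second are the marked points. *)

Definition coords (R : realType) (D : nat) : Type :=
  ('M[Cx R]_(2, D.+1) * 'M[Cx R]_(2 * D - 2, 2))%type.
HB.instance Definition _ (R : realType) (D : nat) :=
  NormedModule.on (coords R D).

Section Lifts.
Variables (R : realType) (D : nat).
Local Notation C := (Cx R).

Definition heval (A : 'M[C]_(2, D.+1)) (v : 'rV[C]_2) : 'rV[C]_2 :=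
  \row_k \sum_(i < D.+1) A k i * (v 0 0 ^+ i * v 0 1 ^+ (D - i)).

(* (P_x, Q_x) and (P_y, Q_y) *)
Definition hevaldx (A : 'M[C]_(2, D.+1)) (v : 'rV[C]_2) : 'rV[C]_2 :=
  \row_k \sum_(i < D.+1) A k i * (i%:R * v 0 0 ^+ i.-1 * v 0 1 ^+ (D - i)).
Definition hevaldy (A : 'M[C]_(2, D.+1)) (v : 'rV[C]_2) : 'rV[C]_2 :=
  \row_k \sum_(i < D.+1)
    A k i * (v 0 0 ^+ i * ((D - i)%:R * v 0 1 ^+ (D - i).-1)).

(* P_x Q_y - P_y Q_x, a form of degree 2D-2 whose zeros are the critical points. *)
Definition jac (A : 'M[C]_(2, D.+1)) (v : 'rV[C]_2) : C :=
  wedge (hevaldx A v) (hevaldy A v).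

(* P and Q have no common zero, so that [P : Q] has degree exactly D, and the
   marked points are the critical points listed with multiplicity. *)
Definition is_lift (x : coords R D) : Prop :=
  [/\ forall v, v != 0 -> heval x.1 v != 0,
      forall j, row j x.2 != 0
    & exists2 kappa : C, kappa != 0 &
        forall v, jac x.1 v = kappa * \prod_(j < 2 * D - 2) wedge (row j x.2) v].

Definition lifts : set (coords R D) := [set x | is_lift x].

Definition scaled (x y : lifts) : Prop :=
  (exists2 a : C, a != 0 & (val y).1 = a *: (val x).1) /\
  forall j, exists2 b : C, b != 0 & row j (val y).2 = b *: row j (val x).2.

Lemma scaled_refl : reflexive (fun x y => `[< scaled x y >]).
Proof.
move=> x; apply/asboolP; split => [|j]; exists 1;
  by rewrite ?oner_neq0 // scale1r.
Qed.

Lemma scaled_sym : symmetric (fun x y => `[< scaled x y >]).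
Proof.
suff H x y : scaled x y -> scaled y x.
  by move=> x y; apply/asboolP/asboolP; exact: H.
move=> [[a a0 ha] hb]; split.
  by exists a^-1; rewrite ?invr_neq0 // ha scalerA mulVf // scale1r.
move=> j; have [b b0 e] := hb j.
by exists b^-1; rewrite ?invr_neq0 // e scalerA mulVf // scale1r.
Qed.

Lemma scaled_trans : transitive (fun x y => `[< scaled x y >]).
Proof.
move=> y x z /asboolP[[a a0 ha] hb] /asboolP[[a' a'0 ha'] hb'].
apply/asboolP; split.
  by exists (a' * a); rewrite ?mulf_neq0 // ha' ha scalerA.
move=> j; have [b b0 e] := hb j; have [b' b'0 e'] := hb' j.
by exists (b' * b); rewrite ?mulf_neq0 // e' e scalerA.
Qed.

Definition scaled_equiv := EquivRel _ scaled_refl scaled_sym scaled_trans.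

End Lifts.
Arguments lifts : clear implicits.

Definition Ratcm (R : realType) (D : nat) : Type :=
  quotient_topology {eq_quot @scaled_equiv R D}.
HB.instance Definition _ (R : realType) (D : nat) := Topological.on (Ratcm R D).
HB.instance Definition _ (R : realType) (D : nat) :=
  Quotient.on (Ratcm R D).

Section Ratcm.
Variables (R : realType) (D : nat).
Local Notation C := (Cx R).
Local Notation Ratcm := (Ratcm R D).

Definition of_lift (x : lifts R D) : Ratcm := \pi_Ratcm x.

(* Everything below is read off a representative; each notion is invariant
   under [scaled]. *)
Definition form (l : Ratcm) : 'M[C]_(2, D.+1) := (val (repr l : lifts R D)).1.

Definition ratmap (l : Ratcm) (z : sphere R) : sphere R :=
  of_hcoord (heval (form l) (hcoord z)).

Definition crit (l : Ratcm) (j : 'I_(2 * D - 2)) : sphere R :=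
  of_hcoord (row j (val (repr l : lifts R D)).2).

Definition conjugate (l m : Ratcm) : Prop :=
  exists2 M : 'M[C]_2, M \in unitmx &
    (forall z, ratmap m (mobius M z) = mobius M (ratmap l z)) /\
    (forall j, crit m j = mobius M (crit l j)).

Lemma conjugate_refl : reflexive (fun l m => `[< conjugate l m >]).
Proof.
move=> l; apply/asboolP; exists 1%:M; first exact: unitmx1.
by split => [z|j]; rewrite !mobius1.
Qed.

Lemma conjugate_sym : symmetric (fun l m => `[< conjugate l m >]).
Proof.
suff H l m : conjugate l m -> conjugate m l.
  by move=> l m; apply/asboolP/asboolP; exact: H.
move=> [M uM [hf hc]]; exists (invmx M); first by rewrite unitmx_inv.
split => [z|j]; last by rewrite hc mobiusK.
by rewrite -{2}(mobiusVK uM z) hf mobiusK.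
Qed.

Lemma conjugate_trans : transitive (fun l m => `[< conjugate l m >]).
Proof.
move=> m l p /asboolP[M uM [hf hc]] /asboolP[N uN [hf' hc']].
apply/asboolP; exists (M *m N); first by rewrite unitmx_mul uM uN.
by split => [z|j]; rewrite -!mobiusM // ?hf' ?hf // hc' hc.
Qed.

Definition conjugate_equiv :=
  EquivRel _ conjugate_refl conjugate_sym conjugate_trans.

End Ratcm.

(* The moduli space rat^cm_D. *)
Definition modcm (R : realType) (D : nat) : Type :=
  quotient_topology {eq_quot @conjugate_equiv R D}.
HB.instance Definition _ (R : realType) (D : nat) := Topological.on (modcm R D).
HB.instance Definition _ (R : realType) (D : nat) :=
  Quotient.on (modcm R D).

Definition to_mod (R : realType) (D : nat) (l : Ratcm R D) : modcm R D :=
  \pi_(modcm R D) l.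

(** * Normality, Fatou and Julia sets, cycles *)

(* Every sequence in the family has a subsequence converging uniformly on the
   compact subsets of U. *)
Definition normal_on (R : realType) (T : topologicalType)
    (F : nat -> T -> sphere R) (U : set T) : Prop :=
  forall s : nat -> nat, exists t : nat -> nat,
    {homo t : m n / (m < n)%N} /\
    exists g : T -> sphere R, forall K : set T, compact K -> K `<=` U ->
      forall e : R, 0 < e ->
        \forall n \near \oo, forall x, K x -> chordal (F (s (t n)) x) (g x) < e.

Section Dynamics.
Variables (R : realType) (D : nat).
Local Notation C := (Cx R).
Local Notation Ratcm := (Ratcm R D).
Local Notation modcm := (modcm R D).

Definition fatou (l : Ratcm) : set (sphere R) :=
  [set z | exists U : set (sphere R),
     [/\ open U, U z & normal_on (fun n => iter n.+1 (ratmap l)) U]].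

Definition julia (l : Ratcm) : set (sphere R) := ~` fatou l.

(* With (P,Q)(v) = a *: v' where v, v' represent z and f(z), the scalar
   jac v / (D a^2) is the derivative of f at z in the local coordinates given by
   v, v'.  If z and f(z) are finite, then a = Q(z,1) and Euler's identity turns
   it into the usual f'(z).  Along a cycle the choice of coordinates cancels. *)
Definition local_deriv (l : Ratcm) (z : sphere R) : C :=
  let w := heval (form l) (hcoord z) in
  let a := if w 0 1 == 0 then w 0 0 else w 0 1 in
  jac (form l) (hcoord z) / (D%:R * a ^+ 2).

Definition multiplier (l : Ratcm) (n : nat) (z : sphere R) : C :=
  \prod_(k < n) local_deriv l (iter k (ratmap l) z).

(* Derivative with respect to the spherical metric; in the affine coordinate it
   equals |f'(z)| (1 + |z|^2) / (1 + |f(z)|^2). *)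
Definition spherical_deriv (l : Ratcm) (z : sphere R) : R :=
  cmod (jac (form l) (hcoord z)) * hnorm (hcoord z) ^+ 2 /
  (D%:R * hnorm (heval (form l) (hcoord z)) ^+ 2).

Definition log_deriv (l : Ratcm) (z : sphere R) : R := ln (spherical_deriv l z).

Definition exact_period (l : Ratcm) (n : nat) (z : sphere R) : Prop :=
  [/\ (0 < n)%N, iter n (ratmap l) z = z &
      forall k, (0 < k < n)%N -> iter k (ratmap l) z <> z].

Definition in_attracting_basin (l : Ratcm) (w : sphere R) : Prop :=
  exists (n : nat) (z : sphere R),
    [/\ exact_period l n z, cmod (multiplier l n z) < 1 &
        iter (k * n) (ratmap l) w @[k --> \oo] --> z].

(** * Parabolic subfamilies *)

Definition coord_vec (x : coords R D) :
    'I_(2 * D.+1 + (2 * D - 2) * 2) -> C :=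
  fun i => row_mx (mxvec x.1) (mxvec x.2) 0 i.

Definition zariski_closed (Z : set Ratcm) : Prop :=
  exists S : set (mpoly.mpoly (2 * D.+1 + (2 * D - 2) * 2) C),
    forall x : lifts R D,
      Z (of_lift x) <-> forall p, S p -> mpoly.meval (coord_vec (val x)) p = 0.

Definition zariski_closure (L : set Ratcm) : set Ratcm :=
  \bigcap_(Z in [set Z | zariski_closed Z /\ L `<=` Z]) Z.

Definition zariski_irreducible (Z : set Ratcm) : Prop :=
  Z !=set0 /\ forall A B, zariski_closed A -> zariski_closed B ->
    Z `<=` A `|` B -> Z `<=` A \/ Z `<=` B.

Definition irreducible_component (X Z : set Ratcm) : Prop :=
  [/\ zariski_irreducible Z, Z `<=` X &
      forall Z', zariski_irreducible Z' -> Z `<=` Z' -> Z' `<=` X -> Z' `<=` Z].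

(* The maps having m distinct cycles, the j-th of period n_j and multiplier
   rho_j. *)
Definition cycle_locus (m : nat) (n : 'I_m -> nat) (rho : 'I_m -> C) :
    set Ratcm :=
  [set l | exists z : 'I_m -> sphere R,
     (forall j, exact_period l (n j) (z j) /\ multiplier l (n j) (z j) = rho j)
     /\ forall i j, i != j -> forall k, iter k (ratmap l) (z i) <> z j].

(* An algebraic family cut out by m >= 0 parabolic relations.  Passing to the
   Zariski closure makes the locus algebraic (cycles may merge in the limit),
   and the locus may be reducible: any union of its components is allowed, in
   particular the whole closure. *)
Definition parabolic_subfamily (Lambda : set modcm) : Prop :=
  exists (m : nat) (n : 'I_m -> nat) (rho : 'I_m -> C),
    (forall j, exists2 q : nat, (0 < q)%N & rho j ^+ q = 1) /\
    exists CC : set (set Ratcm),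
      CC `<=` irreducible_component (zariski_closure (cycle_locus n rho)) /\
      @to_mod R D @^-1` Lambda = \bigcup_(Z in CC) Z.

(** * Stability *)

Definition passive_on (i : 'I_(2 * D - 2)) (U : set modcm) : Prop :=
  normal_on (fun n (l : Ratcm) => iter n.+1 (ratmap l) (crit l i))
    (@to_mod R D @^-1` U).

Definition active_on (i : 'I_(2 * D - 2)) (U : set modcm) : Prop :=
  ~ passive_on i U.

(* The largest relatively open subset of Lambda on which all critical points are
   passive (normality is a local property). *)
Definition stable_locus (Lambda : set modcm) : set modcm :=
  [set x | Lambda x /\ exists U : set modcm,
     [/\ open U, U x & forall i, passive_on i (U `&` Lambda)]].

Definition stable_component (Lambda Omega : set modcm) : Prop :=
  exists2 x, stable_locus Lambda x &
    Omega = connected_component (stable_locus Lambda) x.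

Definition hyperbolic_component (Lambda Omega : set modcm) : Prop :=
  stable_component Lambda Omega /\
  forall l : Ratcm, Omega (to_mod l) -> forall i, active_on i Lambda ->
    in_attracting_basin l (crit l i).

Definition is_component_lift (Omega : set modcm) (Omegat : set Ratcm) : Prop :=
  exists2 l, Omega (to_mod l) &
    Omegat = connected_component (@to_mod R D @^-1` Omega) l.

(** * The motion of the Julia sets *)

(* Locally the restriction of an ambient holomorphic map, in homogeneous
   coordinates on both sides; [differentiable] is over the complex field. *)
Definition holomorphic_on (U : set Ratcm) (g : Ratcm -> sphere R) : Prop :=
  forall x : lifts R D, U (of_lift x) ->
    exists (W : set (coords R D)) (F : coords R D -> 'rV[C]_2),
      [/\ open_nbhs (val x) W, forall y, W y -> differentiable F y &
          forall y : lifts R D, W (val y) -> U (of_lift y) ->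
            F (val y) != 0 /\ g (of_lift y) = of_hcoord (F (val y))].

Definition hoelder_on (A : set (sphere R)) (h : sphere R -> sphere R) : Prop :=
  exists a K : R, 0 < a <= 1 /\
    forall z w, A z -> A w -> chordal (h z) (h w) <= K * chordal z w `^ a.

Definition hoelder_conjugacy (l0 l : Ratcm) (h : sphere R -> sphere R) : Prop :=
  [/\ set_bij (julia l0) (julia l) h,
      {within julia l0, continuous h},
      (exists2 h', {in julia l0, cancel h h'} &
         {within julia l, continuous h'}),
      hoelder_on (julia l0) h &
      forall z, julia l0 z -> h (ratmap l0 z) = ratmap l (h z)].

Definition julia_motion (Omegat : set Ratcm) (l0 : Ratcm) (U : set Ratcm)
    (Psi : Ratcm -> sphere R -> sphere R) : Prop :=
  [/\ U `<=` Omegat,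
      (exists O : set Ratcm, [/\ open O, O l0 & O `&` Omegat `<=` U]),
      (forall z, julia l0 z -> Psi l0 z = z),
      (forall z, julia l0 z -> holomorphic_on U (fun l => Psi l z)) &
      (forall l, U l -> hoelder_conjugacy l0 l (Psi l))].

(** * Entropy and pressure *)

Definition invariant_measure (l : Ratcm) (m : probability (borel_sphere R) R) :
    Prop :=
  m (julia l) = 1%E /\
  forall A : set (borel_sphere R), measurable A -> m (ratmap l @^-1` A) = m A.

(* Entropy of the join of the f^-i(xi), i < n, where the finite partition xi is
   given by its labelling function. *)
Definition partition_entropy (f : sphere R -> sphere R)
    (m : probability (borel_sphere R) R) (k : nat) (xi : sphere R -> 'I_k)
    (n : nat) : R :=
  - \sum_(w : {ffun 'I_n -> 'I_k})
      let p := fine (m [set z | forall i : 'I_n, xi (iter i f z) = w i]) in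
      p * ln p.

Definition entropy (f : sphere R -> sphere R)
    (m : probability (borel_sphere R) R) : \bar R :=
  ereal_sup [set h | exists (k : nat) (xi : sphere R -> 'I_k),
    (forall i, measurable (xi @^-1` [set i] : set (borel_sphere R))) /\
    h = (limn (fun n => partition_entropy f m xi n / n%:R))%:E].

Definition free_energy (l : Ratcm) (phi : sphere R -> R)
    (m : probability (borel_sphere R) R) : \bar R :=
  (entropy (ratmap l) m + \int[m]_(z in julia l) (phi z)%:E)%E.

Definition pressure (l : Ratcm) (phi : sphere R -> R) : \bar R :=
  ereal_sup [set free_energy l phi m | m in invariant_measure l].

Definition equilibrium_state (l : Ratcm) (phi : sphere R -> R)
    (m : probability (borel_sphere R) R) : Prop :=
  invariant_measure l m /\ free_energy l phi m = pressure l phi.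

Definition unique_equilibrium_state (l : Ratcm) (phi : sphere R -> R)
    (m : probability (borel_sphere R) R) : Prop :=
  equilibrium_state l phi m /\
  forall m', equilibrium_state l phi m' ->
    forall A : set (borel_sphere R), measurable A -> m' A = m A.

(* d = delta_eta(l) *)
Definition is_delta (eta : R) (l : Ratcm) (d : R) : Prop :=
  forall t : R,
    pressure l (fun z => - t * log_deriv l z) = eta%:E <-> t = d.

(* Extended-real valued.  [ln 0 = 0] plays no role: the maps of a hyperbolic
   component have no critical point in their Julia set. *)
Definition G (delta : Ratcm -> R) (Psi : Ratcm -> sphere R -> sphere R)
    (nu : probability (borel_sphere R) R) (l0 l : Ratcm) : \bar R :=
  ((delta l)%:E * \int[nu]_(z in julia l0) (log_deriv l (Psi l z))%:E)%E.

End Dynamics.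

(* Main.v *)
(* The measure nu is transported to J_l by the conjugacy Psi_l; the image m is
   f_l-invariant and has the same entropy, so the variational principle on J_l
   gives eta >= h(m) - delta(l) \int log|f_l'| dm >= h(nu) - G(l).  Since nu is
   an equilibrium state, eta = h(nu) - G(l0), whence G(l0) <= G(l).  All identities
   between f_l0 and f_l are only needed nu-almost everywhere, on the points
   whose orbit stays in the Julia set. *)

Require Import Defs.
From mathcomp Require Import all_boot all_order all_algebra.
From mathcomp Require Import all_classical all_reals all_analysis.
From mathcomp Require Import measurable_realfun complex zify ring lra.
Import Order.TTheory GRing.Theory Num.Theory.
Import numFieldNormedType.Exports.
Local Open Scope classical_set_scope.
Local Open Scope ring_scope.
Set Implicit Arguments.
Unset Strict Implicit.

(** * Continuity and boundedness of the spherical derivative *)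

Section ComplexContinuity.
Variable R : realType.
Local Notation C := (Cx R).

Lemma cmod_normr (z : C) : (cmod z)%:C%C = `|z|.
Proof. by []. Qed.

Lemma cmod0_eq (z : C) : cmod z = 0 -> z = 0.
Proof. exact: Normc.eq0_normc. Qed.

Lemma cmodM (z w : C) : cmod (z * w) = cmod z * cmod w.
Proof. exact: Normc.normcM. Qed.

Lemma cmod_ge0 (z : C) : 0 <= cmod z.
Proof. by rewrite -lecR cmod_normr normr_ge0. Qed.

Lemma ler_dist_cmod (z w : C) : `|cmod z - cmod w| <= cmod (z - w).
Proof.
have sub (x y : C) : cmod x - cmod y <= cmod (x - y).
  by have := lerB_dist x y; rewrite -!cmod_normr -raddfB/= lecR.
rewrite ler_norml lerNl opprB sub andbT.
by have := sub w z; rewrite -[in X in _ -> X]lecR cmod_normr distrC -cmod_normr lecR.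
Qed.

Lemma cmod_continuous : continuous (@cmod R : C -> R).
Proof.
move=> z; have Fz : Filter (nbhs z) by apply: nbhs_filter.
apply/cvgrPdist_lt => e e0.
have e0' : 0 < e%:C%C :> C by rewrite ltcR.
have := nbhsx_ballx z e%:C%C e0'.
apply: filterS => w zw; apply: le_lt_trans (ler_dist_cmod _ _) _.
by rewrite -ltcR cmod_normr.
Qed.

Lemma complex_continuous : continuous (fun p : R * R => p.1 +i* p.2 : C)%C.
Proof.
case=> a b; have Fz : Filter (nbhs (a, b)) by apply: nbhs_filter.
apply/cvgrPdist_lt => e; rewrite /= => e0.
(* In the partial order of [C], [0 < e] forces [e] to be a positive real, so the estimate takes
   place in [R]. *)
have [e1 ei] : 0 < complex.Re e /\ e = (complex.Re e)%:C%C.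
  by move: e0; rewrite ltcE/=; case: (e) => x y /= /andP[/eqP -> ->].
have r2 : 0 < complex.Re e / 2 by rewrite divr_gt0.
have := nbhsx_ballx (a, b) (complex.Re e / 2) r2.
apply: filterS => -[x y] [/= ax yb]; rewrite ei -cmod_normr ltcR.
rewrite (@le_lt_trans _ _ (`|a - x| + `|b - y|))//; last first.
  by rewrite (splitr (complex.Re e)) ltrD.
rewrite /cmod/= -[leRHS]ger0_norm ?addr_ge0// -sqrtr_sqr ler_wsqrtr//.
rewrite -(real_normK (num_real (a - x))) -(real_normK (num_real (b - y))).
by rewrite sqrrD -addrA lerD2l addrC lerDl mulrn_wge0// mulr_ge0.
Qed.

Section Combinators.
Variables (K : numFieldType) (T : topologicalType).
Implicit Types f g : T -> K.

Lemma continuousD_fun f g : continuous f -> continuous g ->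
  continuous (fun x => f x + g x).
Proof. by move=> cf cg x; exact: (continuousD (cf x) (cg x)). Qed.

Lemma continuousB_fun f g : continuous f -> continuous g ->
  continuous (fun x => f x - g x).
Proof. by move=> cf cg x; exact: (continuousB (cf x) (cg x)). Qed.

Lemma continuousM_fun f g : continuous f -> continuous g ->
  continuous (fun x => f x * g x).
Proof. by move=> cf cg x; exact: (continuousM (cf x) (cg x)). Qed.

Lemma continuousX_fun f n : continuous f -> continuous (fun x => f x ^+ n).
Proof.
move=> cf; elim: n => [|n ih].
  by under eq_fun do rewrite expr0; move=> x; exact: cst_continuous.
by under eq_fun do rewrite exprS; exact: continuousM_fun.
Qed.

Lemma continuous_sum_fun (I : Type) (r : seq I) (f : I -> T -> K) :
  (forall i, continuous (f i)) -> continuous (fun x => \sum_(i <- r) f i x).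
Proof.
move=> cf; elim: r => [|i r ih].
  by under eq_fun do rewrite big_nil; move=> x; exact: cst_continuous.
by under eq_fun do rewrite big_cons; exact: continuousD_fun.
Qed.

End Combinators.

Lemma row2_continuous (T : topologicalType) (f g : T -> C) k : continuous f -> continuous g ->
  continuous (fun t => (\row_(j < 2) [:: f t; g t]`_j) 0 k).
Proof.
move=> cf cg; have [->|->] : k = 0 \/ k = 1.
    by case: k => [[|[|//]] ?]; [left|right]; apply/val_inj.
  rewrite (_ : (fun t => _) = f); first exact: cf.
  by apply/funext => t; rewrite mxE.
rewrite (_ : (fun t => _) = g); first exact: cg.
by apply/funext => t; rewrite mxE.
Qed.

Lemma hcoord_continuous j : continuous (fun w : C => hcoord (Some w) 0 j).
Proof.
by apply: row2_continuous => w; [exact: cvg_id|exact: cst_continuous].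
Qed.

Section Forms.
Variables (D : nat) (A : 'M[C]_(2, D.+1)) (T : topologicalType).
Variable v : T -> 'rV[C]_2.
Hypothesis cv : forall j, continuous (fun t => v t 0 j).

Let cst_cts (a : C) : continuous (fun _ : T => a).
Proof. by move=> t; exact: cst_continuous. Qed.

Let pow_cts j n : continuous (fun t => v t 0 j ^+ n).
Proof. by apply: continuousX_fun; exact: cv. Qed.

Lemma heval_continuous k : continuous (fun t => heval A (v t) 0 k).
Proof.
rewrite (funext (fun t => mxE _ _ _ _ : heval A (v t) 0 k = _)).
apply: continuous_sum_fun => i; apply: continuousM_fun; first exact: cst_cts.
by apply: continuousM_fun; exact: pow_cts.
Qed.

Lemma hevaldx_continuous k : continuous (fun t => hevaldx A (v t) 0 k).
Proof.
rewrite (funext (fun t => mxE _ _ _ _ : hevaldx A (v t) 0 k = _)).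
apply: continuous_sum_fun => i; apply: continuousM_fun; first exact: cst_cts.
apply: continuousM_fun; last exact: pow_cts.
by apply: continuousM_fun; [exact: cst_cts|exact: pow_cts].
Qed.

Lemma hevaldy_continuous k : continuous (fun t => hevaldy A (v t) 0 k).
Proof.
rewrite (funext (fun t => mxE _ _ _ _ : hevaldy A (v t) 0 k = _)).
apply: continuous_sum_fun => i; apply: continuousM_fun; first exact: cst_cts.
apply: continuousM_fun; first exact: pow_cts.
by apply: continuousM_fun; [exact: cst_cts|exact: pow_cts].
Qed.

Lemma jac_continuous : continuous (fun t => jac A (v t)).
Proof.
apply: continuousB_fun; apply: continuousM_fun.
- exact: hevaldx_continuous.
- exact: hevaldy_continuous.
- exact: hevaldx_continuous.
- exact: hevaldy_continuous.
Qed.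

Lemma hnorm_continuous : continuous (fun t => hnorm (v t)).
Proof.
have cs : continuous (fun t => cmod (v t 0 0) ^+ 2 + cmod (v t 0 1) ^+ 2).
  apply: continuousD_fun; apply: continuousX_fun => s;
    exact: (continuous_comp (@cv _ s) (@cmod_continuous _)).
by move=> t; exact: (continuous_comp (cs t) (@sqrt_continuous R _)).
Qed.

End Forms.
End ComplexContinuity.

(** * Homogeneity of the spherical derivative and its upper bound *)

Section Homogeneity.
Variables (R : realType) (D : nat).
Local Notation C := (Cx R).
Implicit Types (A : 'M[C]_(2, D.+1)) (v : 'rV[C]_2) (a : C).

Lemma hevalZ A a v : heval A (a *: v) = a ^+ D *: heval A v.
Proof.
apply/rowP => k; rewrite !mxE mulr_sumr; apply: eq_bigr => i _.
have -> : a ^+ D = a ^+ i * a ^+ (D - i).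
  by rewrite -exprD subnKC// -ltnS ltn_ord.
by rewrite !exprMn; ring.
Qed.

Lemma hevaldxZ A a v : hevaldx A (a *: v) = a ^+ D.-1 *: hevaldx A v.
Proof.
(* The term [i = 0] is split off: there [i.-1] truncates and the exponents add up to [D] instead of
   [D.-1], but the coefficient vanishes. *)
apply/rowP => k; rewrite !mxE mulr_sumr; apply: eq_bigr => -[[|i] iD] _ /=.
  by rewrite !mul0r !mulr0.
have -> : a ^+ D.-1 = a ^+ i * a ^+ (D - i.+1).
  by rewrite -exprD; congr (_ ^+ _); lia.
by rewrite !exprMn; ring.
Qed.

Lemma hevaldyZ A a v : hevaldy A (a *: v) = a ^+ D.-1 *: hevaldy A v.
Proof.
apply/rowP => k; rewrite !mxE mulr_sumr; apply: eq_bigr => i _.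
(* The same truncation occurs at the other end: for [i = D] the factor [D - i] vanishes. *)
have [iD|iD] := ltnP i D; last first.
  have -> : (D - i = 0)%N by lia.
  by rewrite !mul0r !mulr0.
have -> : a ^+ D.-1 = a ^+ i * a ^+ (D - i).-1.
  by rewrite -exprD; congr (_ ^+ _); lia.
by rewrite !exprMn; ring.
Qed.

Lemma jacZ A a v : jac A (a *: v) = (a ^+ D.-1) ^+ 2 * jac A v.
Proof.
rewrite /jac hevaldxZ hevaldyZ.
by move: (hevaldx A v) (hevaldy A v) => u w; rewrite /wedge !mxE; ring.
Qed.

Lemma hnormZ a v : hnorm (a *: v) = cmod a * hnorm v.
Proof.
rewrite /hnorm !mxE !cmodM !exprMn -mulrDr sqrtrM ?sqr_ge0//.
by rewrite sqrtr_sqr ger0_norm// cmod_ge0.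
Qed.

Lemma hnorm_gt0 v : v != 0 -> 0 < hnorm v.
Proof.
move=> v0; rewrite sqrtr_gt0 lt_neqAle addr_ge0 ?sqr_ge0// andbT eq_sym.
apply: contra v0; rewrite paddr_eq0 ?sqr_ge0// !sqrf_eq0.
move=> /andP[/eqP/cmod0_eq v0 /eqP/cmod0_eq v1].
apply/eqP/rowP => j; rewrite mxE.
by case: j => [[|[|//]] jP]; [rewrite -[RHS]v0|rewrite -[RHS]v1];
  congr (v _ _); apply/val_inj.
Qed.

Lemma form_neq0 (l : Ratcm R D) v : v != 0 -> heval (Defs.form l) v != 0.
Proof. by case: (set_mem (valP (repr l : lifts R D))) => h _ _; exact: h. Qed.

(** The formula of [spherical_deriv] at an arbitrary vector, so that it can also be read in the
    chart at infinity. *)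
Definition hderiv A v : R :=
  cmod (jac A v) * hnorm v ^+ 2 / (D%:R * hnorm (heval A v) ^+ 2).

(** The degrees cancel: the Jacobian contributes [2D - 2] powers of [cmod a], the squared norm of
    [v] contributes [2], and the denominator [2D]. *)
Lemma hderivZ A a v : (0 < D)%N -> a != 0 -> heval A v != 0 ->
  hderiv A (a *: v) = hderiv A v.
Proof.
move=> D0 a0 Av0; rewrite /hderiv jacZ hevalZ !hnormZ.
have cmod_neq0 (b : C) : b != 0 -> cmod b != 0.
  by apply: contra => /eqP/cmod0_eq/eqP.
have -> : a ^+ D = a * a ^+ D.-1 by rewrite -exprS prednK.
rewrite !cmodM.
have := cmod_neq0 _ (expf_neq0 D.-1 a0); have := cmod_neq0 _ a0.
have : hnorm (heval A v) != 0 by rewrite gt_eqF// hnorm_gt0.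
have : D%:R != 0 :> R by rewrite pnatr_eq0 -lt0n.
by move=> *; field; apply/and4P.
Qed.

Lemma hderiv_continuous A (T : topologicalType) (v : T -> 'rV[C]_2) :
  (0 < D)%N -> (forall j, continuous (fun t => v t 0 j)) ->
  (forall t, heval A (v t) != 0) -> continuous (fun t => hderiv A (v t)).
Proof.
move=> D0 cv Av0; apply: continuousM_fun.
  apply: continuousM_fun; last by apply: continuousX_fun; exact: hnorm_continuous.
  move=> t; apply: (continuous_comp (@jac_continuous _ _ A _ _ cv t)).
  exact: cmod_continuous.
have cden : continuous (fun t => D%:R * hnorm (heval A (v t)) ^+ 2 : R).
  apply: continuousM_fun; first by move=> ?; exact: cst_continuous.
  apply: continuousX_fun; apply: hnorm_continuous => j.
  exact: heval_continuous.
move=> t; apply: (continuousV _ (cden t)).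
rewrite mulf_neq0// ?pnatr_eq0 -?lt0n// expf_neq0// gt_eqF//.
exact: hnorm_gt0.
Qed.

(** A square in place of the closed disc: its compactness comes from a product of segments, and it
    contains the disc. *)
Definition unit_box : set C :=
  (fun p : R * R => (p.1 +i* p.2)%C : C) @` (`[(-1), 1] `*` `[(-1), 1]).

Lemma unit_box_compact : compact unit_box.
Proof.
apply: continuous_compact.
  exact/continuous_subspaceT/complex_continuous.
by apply: compact_setX; exact: segment_compact.
Qed.

Lemma unit_boxP (w : C) : cmod w <= 1 -> unit_box w.
Proof.
move=> w1.
have wi : `|complex.Im w| <= 1.
  apply: le_trans w1; case: (w) => a b /=.
  by rewrite /cmod/= -sqrtr_sqr ler_wsqrtr// lerDr sqr_ge0.
have wr : `|complex.Re w| <= 1.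
  apply: le_trans w1; case: (w) => a b /=.
  by rewrite /cmod/= -sqrtr_sqr ler_wsqrtr// lerDl sqr_ge0.
exists (complex.Re w, complex.Im w); last by case: (w).
by split => /=; rewrite in_itv/= -ler_norml.
Qed.

Lemma hderiv_box_bounded A (v : C -> 'rV[C]_2) :
  (0 < D)%N -> (forall j, continuous (fun t => v t 0 j)) ->
  (forall t, heval A (v t) != 0) ->
  exists M : R, forall w, cmod w <= 1 -> hderiv A (v w) <= M.
Proof.
move=> D0 cv Av0.
have := continuous_compact
  (continuous_subspaceT (hderiv_continuous D0 cv Av0)) unit_box_compact.
(* [compact_bounded] provides a bound by every number strictly above [M], hence the witness
   [M + 1]. *)
move=> /compact_bounded[M [_ HM]]; exists (M + 1) => w w1.
apply: le_trans (ler_norm _) _; apply: (HM (M + 1)); first by rewrite ltrDl.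
by exists w => //; exact: unit_boxP.
Qed.

Lemma spherical_derivE (l : Ratcm R D) z :
  spherical_deriv l z = hderiv (Defs.form l) (hcoord z).
Proof. by []. Qed.

Lemma spherical_deriv_bounded (l : Ratcm R D) : (0 < D)%N ->
  exists M : R, forall z, spherical_deriv l z <= M.
Proof.
move=> D0.
pose u0 (w : C) : 'rV[C]_2 := hcoord (Some w).
pose u1 (w : C) : 'rV[C]_2 := \row_j [:: 1; w]`_j.
have c0 j : continuous (fun w => u0 w 0 j) by exact: hcoord_continuous.
have c1 j : continuous (fun w => u1 w 0 j).
  by apply: row2_continuous => w; [exact: cst_continuous|exact: cvg_id].
have n1 w : u1 w != 0.
  by apply/eqP => /rowP/(_ 0); rewrite !mxE/= => /eqP; rewrite oner_eq0.
have [M0 H0] := hderiv_box_bounded D0 c0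
  (fun w => form_neq0 l (hcoord_neq0 (Some w))).
have [M1 H1] := hderiv_box_bounded D0 c1 (fun w => form_neq0 l (n1 w)).
(* [hderiv] is homogeneous of degree 0, so every point can be read in one of the
   two charts on the closed unit disc. *)
exists (Num.max M0 M1) => z; rewrite le_max spherical_derivE.
case: z => [w|].
  have [w1|w1] := lerP (cmod w) 1; first by rewrite H0.
  have w0 : w != 0.
    by apply: contraTneq w1 => ->; rewrite /cmod Normc.normc0 ltr10.
  have -> : hcoord (Some w) = w *: u1 w^-1.
    by apply/rowP => -[[|[|//]] jP]; rewrite !mxE/= ?mulr1// mulfV.
  rewrite hderivZ// ?form_neq0// H1 ?orbT//.
  by rewrite /cmod Normc.normcV invf_le1 ?ltW// (lt_trans _ w1).
have -> : hcoord None = u1 0 :> 'rV[C]_2 by apply/rowP => j; rewrite !mxE.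
by rewrite (H1 0) ?orbT// /cmod Normc.normc0 ler01.
Qed.

(** For a positive derivative [ln x <= x] reduces the claim to the previous bound; at a critical
    point the convention [ln 0 = 0] still agrees with it. Near a critical point the logarithm has no
    lower bound, so later integrals may be [-oo]. *)
Lemma log_deriv_bounded (l : Ratcm R D) : (0 < D)%N ->
  exists M : R, forall z, log_deriv l z <= M.
Proof.
move=> D0; have [M HM] := spherical_deriv_bounded l D0.
exists M => z; apply: le_trans (HM z); rewrite /log_deriv.
have : 0 <= spherical_deriv l z.
  rewrite divr_ge0 ?mulr_ge0 ?cmod_ge0 ?exprn_ge0 ?sqrtr_ge0//.
rewrite le_eqVlt => /predU1P[<-|d0]; first by rewrite ln0.
by rewrite ltW// ln_sublinear.
Qed.

End Homogeneity.

(** * Borel measurability on the sphere *)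

Section SphereMeasurability.
Variable R : realType.
Local Notation C := (Cx R).
Local Notation S := (borel_sphere R).

Lemma open_measurable_sphere (U : set (sphere R)) :
  open U -> measurable (U : set S).
Proof. by move=> oU; exact: sub_sigma_algebra. Qed.

Lemma closed_measurable_sphere (U : set (sphere R)) :
  closed U -> measurable (U : set S).
Proof.
move=> /closed_openC/open_measurable_sphere mU.
by rewrite -(setCK U); exact: measurableC.
Qed.

Lemma measurable_infty : measurable ([set None] : set S).
Proof.
have -> : [set None] = ~` (Some @` [set: C]) :> set (sphere R).
  apply/seteqP; split => -[z|]//=.
  - by move=> _ [].
  - by move=> h; case: h; exists z.
apply: measurableC; apply: open_measurable_sphere.
by apply: one_point_compactification_open_some; exact: openT.
Qed.

(** Such a set differs from an open set by at most the point at infinity, which is Borel.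
    Measurability can thus be tested in the affine chart alone. *)
Lemma measurable_sphere_finite_open (A : set (sphere R)) :
  open (Some @^-1` A : set C) -> measurable (A : set S).
Proof.
move=> oA.
have -> : A = (Some @` (Some @^-1` A : set C)) `|` (A `&` [set None]).
  apply/seteqP; split => [[z|] Az|_ [[z Az <-]//|[]//]].
    by left; exists z.
  by right.
apply: measurableU.
  apply: open_measurable_sphere.
  exact: one_point_compactification_open_some.
have [AN|AN] := pselect (A None).
  rewrite (_ : _ `&` _ = [set None]); first exact: measurable_infty.
  by apply/seteqP; split => [z []//|_ ->].
rewrite (_ : _ `&` _ = set0)//; apply/seteqP; split => // z [Az zN].
by apply: AN; rewrite -zN.
Qed.

Lemma measurable_fun_sphere (d : measure_display) (T : measurableType d)
    (D : set T) (f : T -> sphere R) :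
  (forall U : set (sphere R), open U -> measurable (D `&` f @^-1` U)) ->
  measurable_fun D (f : T -> S).
Proof.
move=> H; apply: (@measurability _ _ T S D f (@open (sphere R))) => //.
by move=> _ [U oU <-]; exact: H.
Qed.

Lemma measurable_sphere_finite_continuous (f : sphere R -> R) :
  continuous (fun w : C => f (Some w)) ->
  measurable_fun setT (f : S -> R).
Proof.
move=> cf; apply: (measurability (@RGenOInfty.G R)).
  exact: RGenOInfty.measurableE.
move=> _ [_ [x ->] <-]; rewrite setTI; apply: measurable_sphere_finite_open.
rewrite -comp_preimage; apply: open_comp => [w _|]; first exact: cf.
exact: interval_open.
Qed.

(** A map known only on [J] is extended by a constant to a total Borel map, as pushing forward a
    measure requires. The preimage of an open set is a relatively open part of [J], together with
    all or nothing of the complement. *)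
Lemma within_continuous_measurable (J : set (sphere R))
    (h : sphere R -> sphere R) (c : sphere R) :
  closed J -> {within J, continuous h} ->
  measurable_fun setT ((fun z => if z \in J then h z else c) : S -> S).
Proof.
move=> cJ ch; apply: measurable_fun_sphere => U oU; rewrite setTI.
have /open_subspaceP[V oV VE] : open (h @^-1` U : set (subspace J)).
  by apply: open_comp => // z _; exact: ch.
have mJ := closed_measurable_sphere cJ.
rewrite (_ : _ @^-1` U = (V `&` J) `|` (~` J `&` [set z | U c])).
  apply: measurableU.
    by apply: measurableI => //; exact: open_measurable_sphere.
  apply: measurableI; first exact: measurableC.
  have [Uc|Uc] := pselect (U c).
    by rewrite (_ : [set _ | _] = setT)//; apply/seteqP; split.
  by rewrite (_ : [set _ | _] = set0)//; apply/seteqP; split.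
rewrite VE; apply/seteqP; split => z /=.
  case: ifPn => [/set_mem Jz Uz|zJ Uc]; [by left|right; split => //].
  by move=> /mem_set; exact/negP.
by case=> [[Uz /mem_set ->]//|[Jz Uc]]; rewrite ifN//; apply/negP => /set_mem.
Qed.

Variable D : nat.

(** The sphere is split along the poles: away from them the map is a quotient of polynomials in the
    affine chart, and on them it is constantly infinite. *)
Lemma measurable_ratmap (l : Ratcm R D) :
  measurable_fun setT (ratmap l : S -> S).
Proof.
apply: measurable_fun_sphere => U oU; rewrite setTI.
pose v z := heval (Defs.form l) (hcoord z).
have cv k : continuous (fun w : C => v (Some w) 0 k).
  by apply: heval_continuous; exact: hcoord_continuous.
have o1 : open [set w : C | v (Some w) 0 1 != 0].
  apply: (@open_comp _ _ (fun w => v (Some w) 0 1) [set x | x != 0]).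
    by move=> w _; exact: cv.
  rewrite (_ : mkset _ = @cmod R @^-1` `]0, +oo[).
    apply: open_comp => [w _|]; first exact: cmod_continuous.
    exact: interval_open.
  apply/seteqP; split => w /=; rewrite in_itv/= andbT lt0r cmod_ge0 andbT.
    by apply: contra => /eqP/cmod0_eq/eqP.
  by apply: contra => /eqP ->; rewrite /cmod Normc.normc0.
have m1 : measurable ([set z | v z 0 1 != 0] : set S).
  exact: measurable_sphere_finite_open.
have m2 : measurable ([set z | v z 0 1 != 0 /\ U (ratmap l z)] : set S).
  apply: measurable_sphere_finite_open.
  rewrite openE => w [/= w0 Uw].
  have o1w : nbhs w [set w : C | v (Some w) 0 1 != 0] by exact: open_nbhs_nbhs.
  have cq := continuousM (@cv 0 w) (continuousV w0 (@cv 1 w)).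
  have oU' : open (Some @^-1` U : set C).
    apply: (@open_comp C (sphere R) Some U) oU => x _.
    exact: one_point_compactification_some_continuous.
  have ratmapE x : v (Some x) 0 1 != 0 ->
      ratmap l (Some x) = Some (v (Some x) 0 0 / v (Some x) 0 1).
    by move=> x0; rewrite /ratmap /of_hcoord ifN.
  have := cq (Some @^-1` U) (open_nbhs_nbhs (conj oU' _)).
  rewrite /= -ratmapE// => /(_ Uw) Unear.
  have : nbhs w ([set w : C | v (Some w) 0 1 != 0] `&`
      [set x | U (Some (v (Some x) 0 0 / v (Some x) 0 1))]).
    exact: (@filterI _ _ (nbhs_filter w)).
  by apply: (@filterS _ _ (nbhs_filter w)) => x [x0] /=; rewrite ratmapE.
have -> : ratmap l @^-1` U =
    [set z | v z 0 1 != 0 /\ U (ratmap l z)] `|`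
    (~` [set z | v z 0 1 != 0] `&` [set z | U None]).
  have rN z : v z 0 1 = 0 -> ratmap l z = None.
    by move=> z0; rewrite /ratmap /of_hcoord ifT//; exact/eqP.
  apply/seteqP; split => z /=.
    have [z0|z0] := eqVneq (v z 0 1) 0; last by left.
    by rewrite rN//; right; split => // /negP; apply.
  by case=> [[]//|[/negP/negPn/eqP z0 UN]]; rewrite rN.
apply: measurableU => //; apply: measurableI; first exact: measurableC.
have [UN|UN] := pselect (U None).
  by rewrite (_ : [set _ | _] = setT)//; apply/seteqP; split.
by rewrite (_ : [set _ | _] = set0)//; apply/seteqP; split.
Qed.

Lemma measurable_log_deriv (l : Ratcm R D) : (0 < D)%N ->
  measurable_fun setT (log_deriv l : S -> R).
Proof.
move=> D0; apply: (measurableT_comp (@measurable_ln R)).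
apply: measurable_sphere_finite_continuous.
apply: hderiv_continuous => //; first exact: hcoord_continuous.
by move=> w; rewrite form_neq0// hcoord_neq0.
Qed.

(** A neighbourhood witnessing normality at one point witnesses it at all of its points, so the
    Fatou set is open. *)
Lemma closed_julia (l : Ratcm R D) : closed (julia l).
Proof.
apply: open_closedC; rewrite openE => z [U [oU Uz nU]].
by rewrite /interior nbhsE; exists U => // w Uw; exists U.
Qed.

End SphereMeasurability.

(** * Sets of full measure and integrals *)

Section FullMeasure.
Context d (T : measurableType d) (R : realType) (P : probability T R).
Implicit Types A B N : set T.

(** This is how identities between the two dynamical systems are used almost everywhere: both sets
    are cut down to [N], whose complement is null. *)
Lemma eq_probability_full A B N : measurable A -> measurable B ->
  measurable N -> P N = 1%E -> (forall x, N x -> A x <-> B x) -> P A = P B.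
Proof.
move=> mA mB mN N1 AB.
have NC0 : P (~` N) = 0%E by rewrite probability_setC// N1 subee.
have PI X : measurable X -> P X = P (X `&` N).
  move=> mX; rewrite (measureDI P mX mN) [X in (X + _)%E](_ : _ = 0%E) ?add0e//.
  apply: (@subset_measure0 _ _ _ P _ (~` N)) => //.
  - exact: measurableD.
  - exact: measurableC.
rewrite (PI A)// (PI B)//; congr (P _).
by apply/seteqP; split => x [Xx Nx]; split => //; apply/(AB x Nx).
Qed.

Lemma probability_fullI A B : measurable A -> measurable B ->
  P A = 1%E -> P B = 1%E -> P (A `&` B) = 1%E.
Proof.
move=> mA mB A1 B1; rewrite -A1; apply: (@eq_probability_full _ _ B) => //.
  exact: measurableI.
by move=> x Bx; split => [[]//|Ax]; split.
Qed.

(** Positive and negative parts are treated separately, since [f] is not assumed integrable. *)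
Lemma integral_full (D J : set T) (f g : T -> \bar R) :
  measurable D -> measurable J -> J `<=` D -> P J = 1%E ->
  measurable_fun D f -> (forall x, J x -> f x = g x) ->
  (\int[P]_(x in D) f x = \int[P]_(x in J) g x)%E.
Proof.
move=> mD mJ JD J1 mf fg.
have N0 : P (~` J) = 0%E.
  by rewrite probability_setC// J1 subee.
have DJ : D `\` ~` J = J.
  by rewrite setDE setCK setIC; exact/setIidl.
transitivity (\int[P]_(x in J) f x)%E.
  rewrite integralE [RHS]integralE; congr (_ - _)%E.
  - rewrite (@ge0_negligible_integral _ _ _ P D (~` J)) ?DJ//.
    + exact: measurableC.
    + exact: measurable_funepos.
  - rewrite (@ge0_negligible_integral _ _ _ P D (~` J)) ?DJ//.
    + exact: measurableC.
    + exact: measurable_funeneg.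
by apply: eq_integral => x /set_mem; exact: fg.
Qed.

End FullMeasure.

(** Change of variables for each of the two nonnegative parts, again without integrability. *)
Lemma integral_distribution_on d1 d2 (X : measurableType d1)
    (Y : measurableType d2) (R : realType) (P : probability X R)
    (h : {mfun X >-> Y}) (D : set Y) (f : Y -> \bar R) :
  measurable D -> measurable_fun D f ->
  (\int[distribution P h]_(y in D) f y =
   \int[P]_(x in h @^-1` D) (f \o h) x)%E.
Proof.
move=> mD mf; rewrite integralE [RHS]integralE.
rewrite (funepos_comp f h) (funeneg_comp f h).
rewrite -[X in (_ = X - _)%E](ge0_integral_pushforward (measurable_funPT h) P)//.
  rewrite -[X in (_ = _ - X)%E](ge0_integral_pushforward (measurable_funPT h) P)//.
  exact: measurable_funeneg.
exact: measurable_funepos.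
Qed.

(* The integral of [f] may be [-oo], but the upper bound rules out the form
   [+oo - +oo], for which the identity fails when [c < 0]. *)
Lemma integralZl_bounded_above d (T : measurableType d) (R : realType)
    (P : probability T R) (D : set T) (f : T -> R) (c M : R) :
  measurable D -> measurable_fun D f -> (forall x, f x <= M) ->
  (\int[P]_(x in D) (c * f x)%:E = c%:E * \int[P]_(x in D) (f x)%:E)%E.
Proof.
move=> mD mf fM; set F := fun x => (f x)%:E.
have mF : measurable_fun D F by exact/measurable_EFinP.
have mFp := measurable_funepos mF; have mFn := measurable_funeneg mF.
set a := (\int[P]_(x in D) F^\+ x)%E; set b := (\int[P]_(x in D) F^\- x)%E.
have a0 : (0 <= a)%E by exact: integral_ge0.
have b0 : (0 <= b)%E by exact: integral_ge0.
have afin : a \is a fin_num.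
  rewrite ge0_fin_numE//; apply: (@le_lt_trans _ _ (`|M|%:E * P D)%E).
    rewrite -integral_cst//; apply: ge0_le_integral => //.
    move=> x _; rewrite funeposE /F ge_max !lee_fin normr_ge0 andbT.
    exact: le_trans (fM x) (ler_norm M).
  have PD1 : (P D <= 1)%E by exact: probability_le1.
  apply: (@le_lt_trans _ _ (`|M|%:E * 1)%E); last by rewrite mule1 ltry.
  exact: lee_wpmul2l.
under eq_integral do rewrite EFinM.
rewrite integralE [in RHS]integralE -/a -/b -/F.
have [c0|c0] := leP 0 c.
  rewrite ge0_funeposM// ge0_funenegM// !ge0_integralZl_EFin// -/a -/b.
  move: a b afin a0 b0 => [r| |] [s| |]// _ r0 _; rewrite -?EFinM -?EFinB ?mulrBr//.
  rewrite mulrNy; have [->|cn0] := eqVneq c 0.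
    by rewrite sgr0 !mul0e mul0r; rewrite subee.
  by rewrite gtr0_sg ?lt0r ?cn0// mul1e mulry gtr0_sg ?lt0r ?cn0// mul1e.
(* For [c < 0] the positive and negative parts change places; [a] is finite, so only [b = +oo]
   remains as an infinite case. *)
rewrite le0_funeposM ?ltW// le0_funenegM ?ltW//.
rewrite -EFinN !ge0_integralZl_EFin ?oppr_ge0 ?ltW// -/a -/b.
move: a b afin a0 b0 => [r| |] [s| |]// _ r0 _.
  by rewrite -?EFinM -?EFinB -?EFinM; congr (_%:E); ring.
by rewrite mulry gtr0_sg ?oppr_gt0// mul1e mulrNy ltr0_sg// mulN1e.
Qed.

(** * Entropy under a semiconjugacy *)

Section Semiconjugacy.
Variable R : realType.
Local Notation S := (borel_sphere R).
Variables (f g : sphere R -> sphere R) (h : {mfun S >-> S}).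
Variables (nu : probability S R) (J : set (sphere R)).
Hypotheses (mf : measurable_fun setT (f : S -> S))
  (mg : measurable_fun setT (g : S -> S)).
Hypotheses (mJ : measurable (J : set S)) (nuJ : nu J = 1%E).
Hypothesis nu_inv : forall A : set S, measurable A -> nu (f @^-1` A) = nu A.
Hypothesis hfg : forall z, J z -> J (f z) -> h (f z) = g (h z).

Let measurable_preimage (k : sphere R -> sphere R) (A : set S) :
  measurable_fun setT (k : S -> S) -> measurable A ->
  measurable (k @^-1` A : set S).
Proof. by move=> mk mA; rewrite -[X in measurable X]setTI; exact: mk. Qed.

Let measurable_iter (k : sphere R -> sphere R) n :
  measurable_fun setT (k : S -> S) -> measurable_fun setT (iter n k : S -> S).
Proof.
move=> mk; elim: n => [|n ih]; first exact: measurable_id.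
exact: (measurableT_comp mk ih).
Qed.

(** The semiconjugacy holds where both [z] and [f z] lie in [J]; by invariance of [nu] this set has
    full measure. *)
Lemma distribution_invariant (A : set S) : measurable A ->
  distribution nu h (g @^-1` A) = distribution nu h A.
Proof.
move=> mA.
have mh : measurable_fun setT (h : S -> S) := measurable_funPT h.
have mhA := measurable_preimage mh mA.
suff : nu (h @^-1` (g @^-1` A)) = nu (h @^-1` A) by [].
rewrite -[RHS]nu_inv//.
have mfJ := measurable_preimage mf mJ.
apply: (@eq_probability_full _ _ _ nu _ _ (J `&` f @^-1` J)).
- exact: (measurable_preimage mh (measurable_preimage mg mA)).
- exact: (measurable_preimage mf mhA).
- exact: measurableI.
- by apply: probability_fullI => //; rewrite nu_inv.
- by move=> z [Jz Jfz] /=; rewrite hfg.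
Qed.

(** The set on which the semiconjugacy can be iterated; the range [i < n] is that of the cylinders
    in [partition_entropy]. *)
Let orbit_in n : set (sphere R) := [set z | forall i, (i < n)%N -> J (iter i f z)].

Let orbit_in_full n : measurable (orbit_in n : set S) /\ nu (orbit_in n) = 1%E.
Proof.
elim: n => [|n [mn n1]].
  rewrite (_ : orbit_in 0 = setT); last by apply/seteqP; split.
  by split=> //; exact: probability_setT.
have -> : orbit_in n.+1 = orbit_in n `&` iter n f @^-1` J.
  apply/seteqP; split => z.
    by move=> Jz; split => [i ni|]; apply: Jz => //; exact: ltnW.
  move=> [Jz Jnz] i; rewrite ltnS leq_eqVlt => /predU1P[->//|]; exact: Jz.
have mJn := measurable_preimage (measurable_iter n mf) mJ.
split; first exact: measurableI.
apply: probability_fullI => //; rewrite -[RHS]nuJ.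
(* Invariance, applied [n] times, gives the preimage of [J] under [iter n f] the measure of [J]. *)
elim: n {mn n1 mJn} => // n ih.
rewrite -ih -[RHS]nu_inv; last first.
  exact: (measurable_preimage (measurable_iter n mf) mJ).
by congr (nu _); apply/seteqP; split => z; rewrite /preimage /mkset -iterSr.
Qed.

Let measurable_cylinder (k : sphere R -> sphere R) m (xi : sphere R -> 'I_m) n
    (w : {ffun 'I_n -> 'I_m}) :
  measurable_fun setT (k : S -> S) ->
  (forall i, measurable (xi @^-1` [set i] : set S)) ->
  measurable ([set z | forall i : 'I_n, xi (iter i k z) = w i] : set S).
Proof.
move=> mk mxi.
rewrite (_ : mkset _ =
  \bigcap_(i in [set: 'I_n]) (iter i k @^-1` (xi @^-1` [set w i]))).
  apply: fin_bigcap_measurable => // i _.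
  exact: (measurable_preimage (measurable_iter i mk) (mxi (w i))).
by apply/seteqP; split => z H i => [_|]; exact: H.
Qed.

(** Along an orbit in [J], [h' (iter i g (h z)) = iter i f z]. Hence [h] pulls each cylinder of
    [xi \o h'] under [g] back to the cylinder of [xi] under [f] with the same word, up to a null
    set. *)
Lemma partition_entropy_distribution (h' : sphere R -> sphere R) m
    (xi : sphere R -> 'I_m) n :
  measurable_fun setT (h' : S -> S) -> {in J, cancel h h'} ->
  (forall i, measurable (xi @^-1` [set i] : set S)) ->
  partition_entropy g (distribution nu h) (xi \o h') n =
  partition_entropy f nu xi n.
Proof.
move=> mh' h'K mxi; congr (- _); apply: eq_bigr => w _.
apply: (congr1 (fun x : \bar R => let p := fine x in p * ln p)).
suff : nu (h @^-1` [set z | forall i : 'I_n, (xi \o h') (iter i g z) = w i]) =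
  nu [set z | forall i : 'I_n, xi (iter i f z) = w i] by [].
have [mn n1] := orbit_in_full n.
apply: (@eq_probability_full _ _ _ nu _ _ (orbit_in n)) => //.
- apply: (measurable_preimage (measurable_funPT h)).
  apply: measurable_cylinder => // i.
  exact: (measurable_preimage mh' (mxi i)).
- exact: measurable_cylinder.
move=> z Jz.
have hiter i : (i < n)%N -> iter i g (h z) = h (iter i f z).
  elim: i => // i ih iltn; rewrite !iterS ih 1?ltnW//.
  by rewrite hfg//; [apply: Jz; exact: ltnW|exact: Jz i.+1 iltn].
by split => H i; have := H i; rewrite /= hiter// h'K//; apply/mem_set/Jz.
Qed.

(** Every partition competing for [nu] yields, through [h'], one for the image measure with the same
    entropies, so the supremum can only grow. *)
Lemma le_entropy_distribution (h' : sphere R -> sphere R) :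
  measurable_fun setT (h' : S -> S) -> {in J, cancel h h'} ->
  (entropy f nu <= entropy g (distribution nu h))%E.
Proof.
move=> mh' h'K; apply: le_ereal_sup => _ [m [xi [mxi ->]]].
exists m, (xi \o h'); split => [i|].
  exact: (measurable_preimage mh' (mxi i)).
congr (_%:E); congr (limn _); apply/funext => n.
by rewrite partition_entropy_distribution.
Qed.

End Semiconjugacy.

(** The partition with a single cell has entropy zero. *)
Lemma entropy_ge0 (R : realType) (f : sphere R -> sphere R)
    (m : probability (borel_sphere R) R) : (0 <= entropy f m)%E.
Proof.
apply: ereal_sup_ubound; exists 1%N, (fun=> ord0); split.
  move=> i; rewrite (_ : _ @^-1` _ = setT)//.
  by apply/seteqP; split => // z _; exact/esym/ord1.
rewrite (_ : (fun n => _) = cst 0) ?lim_cst//; apply/funext => n.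
rewrite /partition_entropy big1 ?oppr0 ?mul0r// => w _.
rewrite (_ : mkset _ = setT); first by rewrite probability_setT/= ln1 mulr0.
by apply/seteqP; split => // z _ i; exact/esym/ord1.
Qed.

(** In the finite case [I0 = h - eta <= h1 - eta <= I1]. As [eta] is real, the equality makes [h]
    and [I0] finite, and the last inequality leaves [I1 = +oo] as the only infinite value of
    [I1]. *)
Lemma ereal_free_energy_comparison (R : realDomainType) (eta : R)
    (h h1 I0 I1 : \bar R) : (0 <= h)%E -> (h <= h1)%E ->
  (h - I0 = eta%:E)%E -> (h1 - I1 <= eta%:E)%E -> (I0 <= I1)%E.
Proof.
move: h h1 I0 I1 => [h| |] [h1| |] [i0| |] [i1| |] //=;
  rewrite ?leey ?leNye ?lee_fin// => _ hh1 [e0] e1.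
by lra.
Qed.

(** * Transport of an invariant measure along the conjugacy of Julia sets *)

Section Transport.
Variables (R : realType) (D : nat) (l0 l : Ratcm R D).
Variables (psi : sphere R -> sphere R) (nu : probability (borel_sphere R) R).
Hypotheses (D0 : (0 < D)%N) (conj : hoelder_conjugacy l0 l psi).
Hypothesis (inv : invariant_measure l0 nu).
Local Notation S := (borel_sphere R).

(* The measure is psi_* nu; the inverse of psi pulls a partition for f_l0 back to
   one for f_l with the same entropies, so entropy does not decrease. *)
Lemma transported_measure : exists2 m : probability S R,
  invariant_measure l m /\ (entropy (ratmap l0) nu <= entropy (ratmap l) m)%E &
  forall c : R,
    (\int[m]_(z in julia l) (c * log_deriv l z)%:E =
     c%:E * \int[nu]_(z in julia l0) (log_deriv l (psi z))%:E)%E.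
Proof.
have [nuJ nu_inv] := inv.
have [psi_bij psi_cts [psi' psiK psi'_cts] _ psi_conj] := conj.
(* The value [None] outside the Julia sets is arbitrary: any constant makes [h] and [h'] Borel on
   the whole sphere. *)
pose h z := if z \in julia l0 then psi z else None.
pose h' z := if z \in julia l then psi' z else None.
have hE z : julia l0 z -> h z = psi z by move=> Jz; rewrite /h mem_set.
have h'E z : julia l z -> h' z = psi' z by move=> Jz; rewrite /h' mem_set.
have psiJ z : julia l0 z -> julia l (psi z).
  by case: psi_bij => psi_fun _ _ Jz; exact: psi_fun.
have mh : measurable_fun setT (h : S -> S).
  exact: (within_continuous_measurable _ (@closed_julia _ _ l0) psi_cts).
have mh' : measurable_fun setT (h' : S -> S).
  exact: (within_continuous_measurable _ (@closed_julia _ _ l) psi'_cts).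
pose hm : {mfun S >-> S} := mfun_Sub (mem_set mh).
have mJ0 : measurable (julia l0 : set S).
  exact: (closed_measurable_sphere (@closed_julia _ _ l0)).
have mJ : measurable (julia l : set S).
  exact: (closed_measurable_sphere (@closed_julia _ _ l)).
have hconj z : julia l0 z -> julia l0 (ratmap l0 z) ->
    hm (ratmap l0 z) = ratmap l (hm z).
  move=> Jz Jfz; rewrite (hE z Jz : hm z = _) (hE _ Jfz : hm _ = _).
  exact: psi_conj.
have h'K : {in julia l0, cancel hm h'}.
  move=> z /[dup] zJ /set_mem Jz.
  have -> : hm z = psi z := hE z Jz.
  by rewrite h'E; [exact: psiK|exact: psiJ].
have subJ : julia l0 `<=` hm @^-1` julia l.
  move=> z Jz; rewrite /preimage /mkset (hE z Jz : hm z = _).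
  exact: (psiJ z Jz).
have mhJ : measurable (hm @^-1` julia l : set S).
  by rewrite -[X in measurable X]setTI; exact: (mh measurableT _ mJ).
exists (distribution nu hm); first split; first split.
- suff : nu (hm @^-1` julia l) = nu setT by rewrite probability_setT.
  apply: (@eq_probability_full _ _ _ nu _ _ (julia l0) mhJ measurableT mJ0 nuJ).
  by move=> z Jz; split=> _; [|exact: subJ].
- exact: (distribution_invariant (measurable_ratmap l0)
    (measurable_ratmap l) mJ0 nuJ nu_inv hconj).
- exact: (le_entropy_distribution (measurable_ratmap l0)
    (measurable_ratmap l) mJ0 nuJ nu_inv hconj mh' h'K).
move=> c; have [M HM] := log_deriv_bounded l D0.
have mlog := measurable_log_deriv l D0.
rewrite (integralZl_bounded_above _ c mJ (measurable_funTS mlog) HM).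
have mElog : measurable_fun setT (fun z : S => (log_deriv l z)%:E).
  exact/measurable_EFinP.
apply: (congr1 (mule c%:E)).
rewrite (integral_distribution_on _ _ mJ (measurable_funTS mElog)).
(* The preimage of [julia l] exceeds [julia l0] if infinity lies in [julia l], but the excess is
   null for [nu]. *)
apply: (@integral_full _ _ _ nu _ _ _ _ mhJ mJ0 subJ nuJ).
  exact: measurable_funTS (measurableT_comp mElog mh).
by move=> z Jz; rewrite /comp (hE z Jz : hm z = _).
Qed.

End Transport.

(** * The minimum of [G] at the base point *)

Unset Implicit Arguments.

Theorem proposition4p5 (R : realType) (D : nat) (hD : (2 <= D)%N)
  (Lambda : set (modcm R D)) (hLambda : parabolic_subfamily Lambda)
  (Omega : set (modcm R D)) (hOmega : hyperbolic_component Lambda Omega)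
  (Omegat : set (Ratcm R D)) (hOmegat : is_component_lift Omega Omegat)
  (eta : R) (heta : 0 < eta < ln D%:R)
  (delta : Ratcm R D -> R)
  (hdelta : forall l, Omegat l -> is_delta eta l (delta l))
  (l0 : Ratcm R D) (hl0 : Omegat l0)
  (U : set (Ratcm R D)) (Psi : Ratcm R D -> sphere R -> sphere R)
  (hPsi : julia_motion Omegat l0 U Psi)
  (nu : probability (borel_sphere R) R)
  (hnu : unique_equilibrium_state l0
           (fun z => - delta l0 * log_deriv l0 z) nu) :
  forall l, U l -> (G delta Psi nu l0 l0 <= G delta Psi nu l0 l)%E.
Proof.
move=> l Ul; have D0 : (0 < D)%N by exact: leq_trans hD.
have [UO _ Psi0 _ Psi_conj] := hPsi.
have [[nu_inv nu_eq] _] := hnu.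
have [m [m_inv hm] mI] := transported_measure D0 (Psi_conj l Ul) nu_inv.
have mJ0 : measurable (julia l0 : set (borel_sphere R)).
  exact: (closed_measurable_sphere (@closed_julia _ _ l0)).
(* The entropies compared are those of [nu] and of its image [m]; [I0] and [I1] are the values of
   [G] at [l0] and [l]. *)
apply: (ereal_free_energy_comparison (entropy_ge0 _ _) hm (eta := eta)).
  have P0 : pressure l0 (fun z => - delta l0 * log_deriv l0 z) = eta%:E.
    exact/(hdelta l0 hl0 (delta l0)).
  rewrite -P0 -nu_eq /free_energy /G; apply: (congr1 (adde _)).
  have [M HM] := log_deriv_bounded l0 D0.
  rewrite (integralZl_bounded_above _ _ mJ0 _ HM); last first.
    exact: measurable_funTS (measurable_log_deriv l0 D0).
  rewrite EFinN mulNe; apply: (congr1 (fun x => - (_ * x))%E).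
  (* The motion is the identity at the base point, so [G] at [l0] integrates [log_deriv l0]
     itself. *)
  by apply: eq_integral => z /set_mem Jz; rewrite Psi0.
have P1 : pressure l (fun z => - delta l * log_deriv l z) = eta%:E.
  exact/(hdelta l (UO l Ul) (delta l)).
(* With [c = - delta l], [mI] turns the left side into the free energy of [m], a competitor in the
   supremum defining the pressure at [l]. *)
rewrite -P1 /G -mulNe -EFinN -mI; apply: ereal_sup_ubound.
by exists m.
Qed.
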